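(* $$\int_0^{\infty} e^{-(\ln x)^2}\,dx = \sqrt[4]{e}\,\sqrt{\pi}.$$
   Context: $\ln$ is the natural logarithm. *)

(* Defs.v *)
From HB Require Import structures.
From mathcomp Require Export all_boot all_order all_algebra.
From mathcomp Require Export all_classical all_reals all_analysis.

(* Main.v *)
(** Substituting [t = ln x] turns the integral into that of [exp (t - t^2)] over
    the real line, and [t - t^2 = 1/4 - (t - 1/2)^2] reduces it to the Gaussian
    integral. The inverse substitution [x = exp t] is less convenient because the
    library's substitution theorem on a half-line requires the derivative of the
    substituted function to have a finite limit at infinity. *)

Require Import Defs.
From mathcomp Require Import measurable_realfun ring.
Import Order.TTheory GRing.Theory Num.Theory.
Import numFieldNormedType.Exports.
Local Open Scope classical_set_scope.
Local Open Scope ring_scope.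

Lemma cvg_lny (R : realType) : ln x @[x --> +oo%R] --> (+oo%R : set_system R).
Proof.
apply/cvgryPge => A; near=> x.
rewrite -ler_expR lnK ?posrE; near: x.
  exact: nbhs_pinfty_ge.
exact: nbhs_pinfty_gt.
Unshelve. all: by end_near. Qed.

Lemma derive1_ln (R : realType) (x : R) : 0 < x -> (@ln R)^`()%classic x = x^-1.
Proof.
by move=> x0; rewrite derive1E; have /@derive_val -> := is_derive1_ln x0.
Qed.

Lemma bigcup_itvNnatcy (R : realType) :
  \bigcup_n `[- n%:R, +oo[%classic = [set: R].
Proof.
apply/seteqP; split => // x _; exists (Num.bound `|x|) => //=.
rewrite in_itv/= andbT lerNl (le_trans (ler_norm _))// normrN.
exact/ltW/archi_boundP.
Qed.

(** The pieces correspond under [ln] to those of [bigcup_itvNnatcy], so the two exhaustions can be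
    compared index by index. *)
Lemma bigcup_itv_expRNnatcy (R : realType) :
  \bigcup_n `[expR (- n%:R), +oo[%classic = `]0%R, +oo[%classic :> set R.
Proof.
apply/seteqP; split => x /=.
  move=> [n _] /=; rewrite !in_itv/= !andbT; apply: lt_le_trans.
  exact: expR_gt0.
rewrite in_itv/= andbT => x0.
(* An index [n] with [- n%:R <= ln x] also works for [x], after exponentiating. *)
have := I : [set: R] (ln x); rewrite -bigcup_itvNnatcy => -[n _] /=.
rewrite in_itv/= andbT => nx; exists n => //=.
by rewrite in_itv/= andbT -[leRHS]lnK ?posrE// ler_expR.
Qed.

Lemma nondecreasing_itvcy (R : realType) (u : nat -> R) :
  {homo u : m n / (m <= n)%N >-> n <= m} ->
  nondecreasing_seq (fun n => `[u n, +oo[%classic : set R).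
Proof.
move=> hu m n mn; rewrite subsetEset; apply: subset_itvr.
by rewrite bnd_simp; exact: hu.
Qed.

Section substitution_ln.
Context {R : realType}.
Let mu := @lebesgue_measure R.
Variable G : R -> R.
Hypothesis cG : continuous G.
Hypothesis G0 : forall t, 0 <= G t.

(** The half-line starts at [expR a] rather than 0 because the substitution theorem needs the
    derivative [x^-1] to have a finite limit at the left endpoint; here the limits are [(expR a)^-1]
    there and 0 at infinity. *)
Lemma ge0_integration_by_substitution_ln_itvcy (a : R) :
  (\int[mu]_(x in `[expR a, +oo[) (G (ln x) / x)%:E
   = \int[mu]_(t in `[a, +oo[) (G t)%:E)%E.
Proof.
have ea0 := expR_gt0 a.
have pos x : expR a <= x -> 0 < x by exact: lt_le_trans.
(* The formula [x^-1] for the derivative is available only at positive points, so limits transfer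
   along filters that are eventually positive. *)
have near_ln (F : set_system R) : Filter F -> (\forall x \near F, 0 < x) ->
    forall l : R, x^-1 @[x --> F] --> l -> (@ln R)^`()%classic x @[x --> F] --> l.
  move=> FF F0 l; apply: cvg_trans; apply: near_eq_cvg.
  by apply: filterS F0 => x x0; rewrite derive1_ln.
(* Writing the endpoint [a] as [ln (expR a)] exhibits the right-hand side as an integral over the
   image of the half-line. *)
rewrite -{2}(expRK a) (@increasing_ge0_integration_by_substitutiony R (@ln R)).
- apply: eq_integral => x; rewrite inE/= in_itv/= andbT => /pos x0.
  by rewrite !fctE derive1_ln.
- move=> x y; rewrite !in_itv/= !andbT => /pos x0 /pos y0 xy.
  by rewrite ltr_ln ?posrE.
- move=> x; rewrite in_itv/= andbT => /ltW/pos x0.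
  rewrite /continuous_at derive1_ln//.
  apply: near_ln; first exact: lt_nbhsr.
  by apply: cvgV; [rewrite gt_eqF|exact: cvg_id].
- apply/cvg_ex; exists (expR a)^-1; apply: near_ln.
    by near=> x; apply: lt_trans ea0 _; near: x; exact: nbhs_right_gt.
  by apply: cvgV; [rewrite gt_eqF|apply: cvg_at_right_filter; exact: cvg_id].
- apply/cvg_ex; exists 0; apply: near_ln; first exact: nbhs_pinfty_gt.
  by apply/gtr0_cvgV0; [exact: nbhs_pinfty_gt|exact: cvg_id].
- split.
    move=> x; rewrite in_itv/= andbT => /ltW/pos x0.
    by have /@ex_derive := is_derive1_ln x0.
  by apply: cvg_at_right_filter; exact: continuous_ln.
- exact: cvg_lny.
- exact: continuous_subspaceT.
- by move=> x _; exact: G0.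
Unshelve. all: by end_near. Qed.

(** Monotone exhaustion: since [G] is nonnegative, each side is the limit of its integrals over the
    growing half-lines, and these agree term by term by the previous lemma. *)
Lemma ge0_integration_by_substitution_ln :
  (\int[mu]_(x in `]0%R, +oo[) (G (ln x) / x)%:E = \int[mu]_t (G t)%:E)%E.
Proof.
have mG : measurable_fun setT G by exact: continuous_measurable_fun.
have mono m n : (m <= n)%N -> - n%:R <= - m%:R :> R.
  by move=> mn; rewrite lerN2 ler_nat.
rewrite -bigcup_itv_expRNnatcy -bigcup_itvNnatcy.
apply: (@cvg_unique _ _
    ((\int[mu]_(t in `[(- n%:R)%R, +oo[) (G t)%:E)%E @[n --> \oo])).
- exact: ereal_hausdorff.
- rewrite -(funext (fun n : nat =>
    ge0_integration_by_substitution_ln_itvcy (- n%:R))).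
  apply: ge0_nondecreasing_set_cvg_integral.
  + by apply: nondecreasing_itvcy => m n mn; rewrite ler_expR mono.
  + by move=> n; exact: measurable_itv.
  + move=> n; apply/measurable_EFinP.
    (* The integrand is continuous on the open half-line of positive reals, hence measurable there
       and on each piece. *)
    apply: (measurable_funS (measurable_itv `]0, +oo[)).
      by apply: subset_itvr; rewrite bnd_simp expR_gt0.
    apply: open_continuous_measurable_fun; first exact: interval_open.
    move=> x; rewrite inE/= in_itv/= andbT => x0; apply: continuousM.
      by apply: continuous_comp; [exact: continuous_ln|exact: cG].
    by apply: cvgV; [rewrite gt_eqF|exact: cvg_id].
  + move=> n x /=; rewrite in_itv/= andbT => nx.
    by rewrite lee_fin divr_ge0// (le_trans _ nx)// expR_ge0.
- apply: ge0_nondecreasing_set_cvg_integral.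
  + exact: nondecreasing_itvcy.
  + by move=> n; exact: measurable_itv.
  + by move=> n; apply/measurable_EFinP/measurable_funTS.
  + by move=> n x _; rewrite lee_fin.
Qed.

End substitution_ln.

(** A translation is an increasing bijection of the line with derivative 1. *)
Lemma integralT_gauss_shift (R : realType) (c : R) :
  (\int[@lebesgue_measure R]_t (gauss_fun (t - c))%:E = (Num.sqrt pi)%:E)%E.
Proof.
pose F (t : R) := t - c.
have F'E : F^`()%classic = cst 1.
  by apply/funext => t; rewrite derive1E deriveB// derive_id derive_cst subr0.
rewrite -integralT_gauss.
rewrite [RHS](@increasing_ge0_integration_by_substitutionT _ F gauss_fun).
- by apply: eq_integral => t _; rewrite !fctE F'E mulr1.
- by move=> x y xy; rewrite ltrD2r.
- by rewrite F'E => ?; exact: cvg_cst.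
- by rewrite F'E; exact: is_cvg_cst.
- by rewrite F'E; exact: is_cvg_cst.
- by move=> t; exact: derivableB.
- exact: cvg_addrr_Ny.
- exact: cvg_addrr.
- exact: continuous_gauss_fun.
- exact: gauss_fun_ge0.
Qed.

Theorem theorem3p1 (R : realType) :
  (\int[@lebesgue_measure R]_(x in `]0%R, +oo[) (expR (- (ln x) ^+ 2))%:E
   = ((expR 1) `^ (4^-1) * Num.sqrt pi)%:E)%E.
Proof.
(* Completing the square: with [c] below, [c * H t] equals [expR (t - t ^+ 2)]. *)
pose H (t : R) := gauss_fun (t - 2^-1).
have cH : continuous H.
  move=> t; apply: (cvg_comp (fun t => t - 2^-1)); last first.
    exact: continuous_gauss_fun.
  by apply: cvgB; [exact: cvg_id|exact: cvg_cst].
pose c : R := expR 4^-1.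
have -> : (expR 1 : R) `^ 4^-1 = c by rewrite -expRM mul1r.
transitivity (\int[@lebesgue_measure R]_(x in `]0%R, +oo[)
    ((c * H (ln x)) / x)%:E)%E.
  apply: eq_integral => x; rewrite inE/= in_itv/= andbT => x0; congr EFin.
  (* Turning the divisor [x] into [expR (ln x)] makes both sides single exponentials, leaving a
     polynomial identity in [ln x]. *)
  rewrite -[X in _ / X]lnK ?posrE// -expRN /c /H /gauss_fun -!expRD; congr expR.
  by field.
rewrite (@ge0_integration_by_substitution_ln R (fun t => c * H t)).
- under eq_integral do rewrite EFinM.
  rewrite ge0_integralZl//.
  + by rewrite integralT_gauss_shift.
  + by apply/measurable_EFinP; exact: continuous_measurable_fun.
  + by move=> t _; rewrite lee_fin gauss_fun_ge0.
  + by rewrite lee_fin expR_ge0.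
- by move=> t; apply: cvgM; [exact: cvg_cst|exact: cH].
- by move=> t; rewrite mulr_ge0 ?expR_ge0// gauss_fun_ge0.
Qed.
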